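(* Let $\Phi=\{\varphi_\nu\}_{\nu=1}^\infty\subset\mathcal A(\mathbb R^n)$ be a family of convex functions on $\mathbb R^n$ satisfying the following conditions: (i$_0$) for each $\nu\in\mathbb N$ and each $A>0$ there is a constant $C_{\nu,A}>0$ such that $\varphi_\nu(x)+A\ln(1+\|x\|)\le\varphi_{\nu+1}(x)+C_{\nu,A}$ for all $x\in\mathbb R^n$; (i$_2$) for each $\nu\in\mathbb N$ there is a constant $K_\nu>0$ such that $\varphi_\nu(x+\xi)\le\varphi_{\nu+1}(x)+K_\nu$ for all $x\in[0,\infty)^n$, $\xi\in[0,1]^n$; (i$_3$) for each $\nu\in\mathbb N$ there is a constant $a_\nu>0$ such that $\varphi_\nu(2x)\le\varphi_{\nu+1}(x)+a_\nu$ for all $x\in\mathbb R^n$. Then $G(\Psi^* )=GS(\Phi^* )$ as topological vector spaces.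
   Context: Let $n\in\mathbb N$; $\mathbb Z_+=\{0,1,2,\dots\}$; $\|\cdot\|$ is the Euclidean norm on $\mathbb R^n$; $\langle u,v\rangle=u_1v_1+\cdots+u_nv_n$. Standard multi-index notation is used ($|\alpha|=\alpha_1+\cdots+\alpha_n$, $\alpha!=\alpha_1!\cdots\alpha_n!$, $x^\beta=x_1^{\beta_1}\cdots x_n^{\beta_n}$, $D^\alpha=\partial^{|\alpha|}/\partial x_1^{\alpha_1}\cdots\partial x_n^{\alpha_n}$). $\mathcal A(\mathbb R^n)$ is the set of all real-valued $g\in C(\mathbb R^n)$ such that: 1) $g(x)=g(|x_1|,\dots,|x_n|)$ for all $x\in\mathbb R^n$; 2) the restriction of $g$ to $[0,\infty)^n$ is nondecreasing in each variable; 3) $\lim_{x\to\infty}g(x)/\|x\|=+\infty$. For $g:\mathbb R^n\to[-\infty,+\infty]$ the Young-Fenchel conjugate is $g^*(x)=\sup_{y\in\mathbb R^n}(\langle x,y\rangle-g(y))$, $x\in\mathbb R^n$. Put $\psi_\nu(x)=\varphi_\nu(e^{x_1},\dots,e^{x_n})$ for $x\in\mathbb R^n$. $G(\psi_\nu^* )$ is the space of all (complex-valued) $f\in C^\infty(\mathbb R^n)$ such that for every $m\in\mathbb Z_+$ $$\|f\|_{m,\psi_\nu^*}=\sup_{x\in\mathbb R^n,\ |\alpha|\le m,\ \beta\in\mathbb Z_+^n}\frac{|x^\beta(D^\alpha f)(x)|}{\beta!\,e^{-\psi_\nu^*(\beta)}}<\infty,$$ with the topology defined by the norms $\|\cdot\|_{m,\psi_\nu^*}$,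 $m\in\mathbb Z_+$. $G(\Psi^* )=\bigcup_{\nu\ge1}G(\psi_\nu^* )$ is equipped with the (locally convex) inductive limit topology of the spaces $G(\psi_\nu^* )$. $GS(\varphi_\nu^* )$ is the space of all (complex-valued) $f\in C^\infty(\mathbb R^n)$ such that for every $m\in\mathbb Z_+$ $$q_{m,\nu}(f)=\sup_{x\in\mathbb R^n,\ |\alpha|\le m}\frac{|(D^\alpha f)(x)|}{e^{-\varphi_\nu^*(x)}}<\infty,$$ with the topology defined by the norms $q_{m,\nu}$, $m\in\mathbb Z_+$. $GS(\Phi^* )=\bigcup_{\nu\ge1}GS(\varphi_\nu^* )$ is equipped with the (locally convex) inductive limit topology of the spaces $GS(\varphi_\nu^* )$. *)

(* Defs.v *)
From HB Require Import structures.
From mathcomp Require Import all_boot all_order all_algebra.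
From mathcomp Require Import all_classical all_reals all_analysis.
From mathcomp.real_closed Require Import complex.
Set Implicit Arguments.
Unset Strict Implicit.
Unset Printing Implicit Defensive.
Import Order.TTheory GRing.Theory Num.Theory.
Import numFieldNormedType.Exports.
Local Open Scope classical_set_scope.
Local Open Scope ring_scope.

(** * Locally convex inductive limits of seminormed subspaces

    All spaces are subsets [E : set V] of one fixed K-vector space [V], from
    which they inherit their linear structure; a topology on [E] is a topology
    on the type of elements of [E].  Seminorms are [\bar R]-valued functions on
    the whole of [V]. *)

Definition seminormed (K : numDomainType) (V : lmodType K) (R : realType)
  (E : set V) (p : nat -> V -> \bar R) : Type := set_type E.

Section seminormed_topology.
Context (K : numDomainType) (V : lmodType K) (R : realType).
Context (E : set V) (p : nat -> V -> \bar R).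

Definition seminorm_ball (m : nat) (f : set_type E) (e : R) : set (set_type E) :=
  [set g | (p m (set_val g - set_val f) < e%:E)%E].

Definition seminorm_subbase : set (set (set_type E)) :=
  [set B | exists m f (e : R), 0 < e /\ B = seminorm_ball m f e].

HB.instance Definition _ := Choice.on (seminormed E p).
HB.instance Definition _ :=
  isSubBaseTopological.Build (seminormed E p) seminorm_subbase id.

End seminormed_topology.

(* [t] makes [E] a locally convex space: ([E], [t]) is linearly homeomorphic to
   a [tvsType], the library's locally convex topological vector spaces.
   Linearity of [h] is expressed relationally because a set [E] which is a linear
   subspace carries no canonical [lmodType] structure. *)
Definition locally_convex_topology (K : numDomainType) (V : lmodType K)
    (E : set V) (t : Topological (set_type E)) : Prop :=
  exists (X : tvsType K) (h : set_type E -> X),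
    [/\ bijective h,
        forall (a : K) (u v w : set_type E),
          set_val w = a *: set_val u + set_val v -> h w = a *: h u + h v &
        forall U : set X,
          open U <-> @open (Topological.Pack t) (h @^-1` U)].

Definition ind_limit (K : numDomainType) (V : lmodType K) (R : realType)
  (E : nat -> set V) (p : nat -> nat -> V -> \bar R) : Type :=
  set_type (\bigcup_k E k).

Section inductive_limit.
Context (K : numDomainType) (V : lmodType K) (R : realType).
Context (E : nat -> set V) (p : nat -> nat -> V -> \bar R).

Definition union_incl (nu : nat) (f : seminormed (E nu) (p nu)) :
    set_type (\bigcup_k E k) :=
  exist _ (set_val f)
    (mem_set (bigcup_sup (F := E) (i := nu) I (set_valP f))).

(* The locally convex topologies on the union of the [E nu] for which all the
   inclusions are continuous. *)
Definition admissible_topology (t : Topological (set_type (\bigcup_k E k))) :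
    Prop :=
  locally_convex_topology t /\
  forall nu, continuous
    (@union_incl nu : seminormed (E nu) (p nu) -> Topological.Pack t).

(* The locally convex inductive limit topology is the finest admissible one,
   namely the supremum of all of them: it is generated by all sets which are open
   for some admissible topology.  ([sup_topology] cannot be indexed by all the
   topologies of a type, for universe reasons.) *)
Definition ind_limit_subbase : set (set (set_type (\bigcup_k E k))) :=
  [set B : set (set_type (\bigcup_k E k)) |
     exists2 t, admissible_topology t & @open (Topological.Pack t) B].

HB.instance Definition _ := Choice.on (ind_limit E p).
HB.instance Definition _ :=
  isSubBaseTopological.Build (ind_limit E p) ind_limit_subbase id.

(* Open sets of the inductive limit as subsets of [V], so that inductive limits
   with propositionally equal carriers can be compared. *)
Definition ind_limit_open : set (set V) :=
  [set U | U `<=` \bigcup_k E k /\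
           @open (ind_limit E p) (set_val @^-1` U)].

End inductive_limit.

(** * Functions on R^n *)

Section functions.
Context (R : realType) (n : nat).
Local Notation Rn := 'rV[R]_n.
Implicit Types (x y : Rn) (alpha beta : {ffun 'I_n -> nat}).

Definition dotp x y : R := \sum_(i < n) x 0 i * y 0 i.

(* Euclidean norm; the library norm on [Rn] is the sup norm. *)
Definition enorm x : R := Num.sqrt (dotp x x).

Definition in_orthant x : Prop := forall i, 0 <= x 0 i.

Definition classA (g : Rn -> R) : Prop :=
  [/\ continuous g,
      forall x, g x = g (map_mx Num.norm x),
      forall x i (h : R), in_orthant x -> 0 <= h ->
        g x <= g (x + h *: delta_mx 0 i) &
      forall M : R, exists r : R, forall x, r < enorm x -> M < g x / enorm x].

(* Young-Fenchel conjugate *)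
Definition conjugate (g : Rn -> \bar R) (x : Rn) : \bar R :=
  ereal_sup [set ((dotp x y)%:E - g y)%E | y in [set: Rn]].

Definition exp_subst (g : Rn -> R) (x : Rn) : R := g (map_mx expR x).

(** Multi-indices are finite functions ['I_n -> nat]. *)
Definition mlen alpha : nat := (\sum_(i < n) alpha i)%N.
Definition mfact alpha : nat := (\prod_(i < n) (alpha i)`!)%N.
Definition mpow x beta : R := \prod_(i < n) x 0 i ^+ beta i.
Definition mvec beta : Rn := \row_i (beta i)%:R.

(* Iterated partial derivatives; the leftmost index is applied last. *)
Definition partials (s : seq 'I_n) (g : Rn -> R) : Rn -> R :=
  foldr (fun i h => 'D_(delta_mx 0 i) h) g s.

Definition smooth (g : Rn -> R) : Prop :=
  forall s : seq 'I_n, continuous (partials s g) /\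
    forall (i : 'I_n) x, derivable (partials s g) x (delta_mx 0 i).

Definition mindex_seq alpha : seq 'I_n :=
  flatten [seq nseq (alpha i) i | i <- enum 'I_n].

(* Complex-valued functions: [R[i]^o] is [R[i]] as a vector space over itself.
   Differentiation is with respect to real variables, componentwise. *)
Definition cfun : lmodType (R[i] : numDomainType) := Rn -> R[i]^o.

Definition cRe (f : cfun) : Rn -> R := fun x => complex.Re (f x).
Definition cIm (f : cfun) : Rn -> R := fun x => complex.Im (f x).

Definition csmooth (f : cfun) : Prop := smooth (cRe f) /\ smooth (cIm f).

Definition mderiv alpha (f : cfun) (x : Rn) : R[i] :=
  Complex (partials (mindex_seq alpha) (cRe f) x)
          (partials (mindex_seq alpha) (cIm f) x).

(* In [R[i]] the modulus [`|z|] is itself a complex number. *)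
Definition cmod (z : R[i]) : R := complex.Re `|z|.

Definition G_norm (psi : Rn -> R) (m : nat) (f : cfun) : \bar R :=
  ereal_sup [set v | exists x alpha beta, (mlen alpha <= m)%N /\
    v = ((cmod (real_complex R (mpow x beta) * mderiv alpha f x))%:E /
      ((mfact beta)%:R%:E * expeR (- conjugate (EFin \o psi) (mvec beta))))%E].

Definition G_space (psi : Rn -> R) : set cfun :=
  [set f | csmooth f /\ forall m, (G_norm psi m f < +oo)%E].

Definition GS_norm (phi : Rn -> R) (m : nat) (f : cfun) : \bar R :=
  ereal_sup [set v | exists x alpha, (mlen alpha <= m)%N /\
    v = ((cmod (mderiv alpha f x))%:E /
      expeR (- conjugate (EFin \o phi) x))%E].

Definition GS_space (phi : Rn -> R) : set cfun :=
  [set f | csmooth f /\ forall m, (GS_norm phi m f < +oo)%E].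

End functions.

(* Main.v *)
Require Import Defs.
From mathcomp Require Import all_boot all_order all_algebra.
From mathcomp Require Import all_classical all_reals all_analysis.
From mathcomp Require Import ring lra.
From mathcomp.real_closed Require Import complex.
Import Order.TTheory GRing.Theory Num.Theory.
Import numFieldNormedType.Exports.
Local Open Scope classical_set_scope.
Local Open Scope ring_scope.

(**
The two scales of norms are interleaved, by two estimates that hold for every
function [f], and interleaved scales have the same inductive limit.

From decay to moments ([G_norm_le_GS_norm]).  Write [psi] for [exp_subst phi].
For [x] and [y] with nonnegative coordinates, [(x y)^beta <= beta! e^<x, y>],
which is one term of the exponential series in each coordinate, and Young's
inequality bounds [<x, y>] by [phi y + phi^* x].  Dividing by [e^(phi y)] and
taking the supremum over [y = e^t] turns [y^beta e^(- phi y)] into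
[e^(psi^* beta)], so that [|x^beta| e^(psi^* beta) / beta! <= e^(phi^* x)].

From moments to decay ([GS_norm_le_G_norm]).  Conversely, the terms of the series
of [e^t] are those of [e^(2 t)] with the summable weights [2^(-k)], so that
[e^t <= 3 (2 t)^k / k!] for some [k]; taking such a [k] in each coordinate gives
[e^<x, y> <= 3^n x^beta (2 y)^beta / beta!] for some [beta].  By definition of
[psi^*], [(2 y)^beta <= (2 y + 1)^beta <= e^(psi^* beta + phi (2 y + 1))], the
shift by 1 making all the coordinates positive.  The translation and dilation
hypotheses on the family bound [phi_nu (2 y + 1)] by [phi_(nu+2) y + C], and the
supremum over [y] of [<x, y> - phi_(nu+2) y] is the conjugate at [x].  Passing
from [nu] to [nu + 2] is the only loss of index.

Topology ([ind_limit_open_sub]).  The two estimates make each step of one scale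
a subspace of some step of the other one, with continuous inclusion.  Hence a
locally convex topology on the common union is admissible for one scale if and
only if it is admissible for the other, and the finest ones coincide.
*)

Set Implicit Arguments.
Unset Strict Implicit.
Unset Printing Implicit Defensive.

(** * Topologies generated by a subbase *)

Definition generated_by {X : topologicalType} (S : set (set X)) : Prop :=
  @open X = [set \bigcup_(A in D) A | D in subset^~ (finI_from S id)].

Lemma generated_by_open {X : topologicalType} (S : set (set X)) B :
  generated_by S -> S B -> open B.
Proof.
move=> -> SB; exists [set B]; last by rewrite bigcup_set1.
by move=> _ ->; exact: finI_from1.
Qed.

Lemma open_preimage_generated (T X : topologicalType) (S : set (set X))
    (h : T -> X) :
  generated_by S -> (forall B, S B -> open (h @^-1` B)) ->
  forall O, open O -> open (h @^-1` O).
Proof.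
move=> -> hS _ [D sD <-]; rewrite preimage_bigcup.
apply: bigcup_open => A /sD[G sG <-]; rewrite preimage_bigcap openE => x hx.
apply: filter_bigI => B GB; apply: open_nbhs_nbhs; split; last exact: hx.
by apply: hS; apply: set_mem; exact: sG.
Qed.

(** * Comparison of inductive limits *)

Section transfer.
Context (K : numDomainType) (V : lmodType K) (R : realType).

Definition subset_incl (A B : set V) (AB : A `<=` B) (f : set_type A) :
    set_type B := exist _ (set_val f) (mem_set (AB _ (set_valP f))).

Lemma seminormed_generated (E : set V) (p : nat -> V -> \bar R) :
  @generated_by (seminormed E p) (seminorm_subbase (E:=E) p).
Proof. by []. Qed.

Lemma ind_limit_generated (E : nat -> set V) (p : nat -> nat -> V -> \bar R) :
  @generated_by (ind_limit E p) (ind_limit_subbase (E:=E) p).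
Proof. by []. Qed.

(** The preimage of a ball [p m (h - f) < e] may have its centre [f] outside of
    [F]: it is the triangle inequality in [E] that fits a [q]-ball around each of
    its points. *)
Lemma seminormed_incl_open (E F : set V) (p q : nat -> V -> \bar R)
    (FE : F `<=` E) :
  (forall m f, (0 <= p m f)%E) ->
  (forall m f g h, E f -> E g -> E h ->
    (p m (h - f)%R <= p m (h - g)%R + p m (g - f)%R)%E) ->
  (forall m, (q m 0%R <= 0)%E) ->
  (forall m, exists2 C : R, 0 < C & forall f, (p m f <= C%:E * q m f)%E) ->
  forall O, @open (seminormed E p) O ->
    @open (seminormed F q) (subset_incl FE @^-1` O).
Proof.
move=> p0 ptri q0 pq.
apply: (open_preimage_generated (T := seminormed F q)
         (X := seminormed E p) (@seminormed_generated E p)).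
move=> _ [m [f [e [e0 ->]]]].
have [C C0 pqC] := pq m; rewrite openE => g.
rewrite /preimage /= /seminorm_ball /= => gf.
have pfin : p m (set_val g - set_val f) \is a fin_num.
  by rewrite ge0_fin_numE ?p0//; apply: lt_trans gf _; rewrite ltry.
set r := fine (p m (set_val g - set_val f)).
have re : r < e by rewrite -lte_fin fineK.
pose d := (e - r) / C.
have d0 : 0 < d by rewrite divr_gt0// subr_gt0.
exists (seminorm_ball q m g d); split.
- apply: generated_by_open (@seminormed_generated F q) _.
  by exists m, g, d.
- by rewrite /seminorm_ball /= subrr; apply: le_lt_trans (q0 m) _; rewrite lte_fin.
- move=> h; rewrite /seminorm_ball /= => hg.
  have EF (k : set_type F) : E (set_val k) by exact: (FE _ (set_valP k)).
  apply: le_lt_trans (ptri m _ _ _ (set_valP f) (EF g) (EF h)) _.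
  rewrite -[p m (set_val g - _)]fineK// -/r -lteBrDr// -EFinB.
  apply: le_lt_trans (pqC _) _.
  have -> : e - r = C * d by rewrite /d mulrC divfK// gt_eqF.
  by rewrite EFinM lte_pmul2l// ?lte_fin//.
Qed.

(** [admissible_topology] for a topology whose carrier [A] is not syntactically
    the union: it makes sense for the same topology and two scales with
    propositionally equal unions. *)
Definition admissible_on (E : nat -> set V) (p : nat -> nat -> V -> \bar R)
    (A : set V) (t : Topological (set_type A)) : Prop :=
  locally_convex_topology t /\
  forall nu (EA : E nu `<=` A) U, @open (Topological.Pack t) U ->
    @open (seminormed (E nu) (p nu)) (subset_incl EA @^-1` U).

Lemma admissible_onE E p (t : Topological (set_type (\bigcup_k E k))) :
  admissible_topology p t <-> @admissible_on E p _ t.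
Proof.
have inclE nu (EA : E nu `<=` \bigcup_k E k) :
  subset_incl EA = @union_incl K V R E p nu.
  by apply/funext => f; exact: val_inj.
split=> -[lc ct]; split=> // nu.
  by move=> EA U oU; rewrite inclE; have /continuousP := ct nu; exact.
apply/continuousP => U oU; rewrite -(inclE nu (bigcup_sup (F := E) I)).
exact: ct oU.
Qed.

(** The carrier is a variable [A], so that the equation can be substituted
    instead of transporting the topology along it. *)
Lemma admissible_on_subbase (E : nat -> set V) (p : nat -> nat -> V -> \bar R)
    (A : set V) (EA : \bigcup_k E k `<=` A) (t : Topological (set_type A))
    (B : set (set_type A)) :
  A = \bigcup_k E k -> admissible_on E p t -> @open (Topological.Pack t) B ->
  ind_limit_subbase p (subset_incl EA @^-1` B).
Proof.
move=> AE; rewrite AE in t EA B *; move=> /admissible_onE tE oB; exists t => //.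
rewrite (_ : _ @^-1` B = B)//.
by apply/funext => f; congr (B _); exact: val_inj.
Qed.

(** The inclusion of [F nu] into the union factors through [E mu], so every
    topology admissible for [E] is admissible for [F]. *)
Lemma ind_limit_open_sub (E F : nat -> set V) (p q : nat -> nat -> V -> \bar R) :
  \bigcup_k E k = \bigcup_k F k ->
  (forall nu, exists mu, exists FE : F nu `<=` E mu,
    forall O, @open (seminormed (E mu) (p mu)) O ->
      @open (seminormed (F nu) (q nu)) (subset_incl FE @^-1` O)) ->
  ind_limit_open E p `<=` ind_limit_open F q.
Proof.
move=> EF incl U [UE oU]; split; first by rewrite -EF.
have FE : \bigcup_k F k `<=` \bigcup_k E k by rewrite EF.
apply: (open_preimage_generated (T := ind_limit F q) (X := ind_limit E p)
  (h := subset_incl FE) (@ind_limit_generated E p) _ oU).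
move=> B [t /admissible_onE tE oB].
apply: generated_by_open (@ind_limit_generated F q) _.
apply: admissible_on_subbase oB => //.
split=> [|nu FA W oW]; first exact: tE.1.
have [mu [FEm cont]] := incl nu.
have EA : E mu `<=` \bigcup_k E k by exact: bigcup_sup.
rewrite (_ : subset_incl FA @^-1` W =
  subset_incl FEm @^-1` (subset_incl EA @^-1` W)); last first.
  by apply/funext => f; congr (W _); exact: val_inj.
by apply: cont; exact: tE.2.
Qed.

End transfer.

(** * One term of the exponential series *)

Section exponential.
Context {R : realType}.
Implicit Types t : R.

(** Otherwise [t^k / k! < 2^(-k) e^t / 3] for all [k], and summing over [k] gives
    [e^t <= 2 e^t / 3]; any constant above the sum 2 of the geometric series
    would do instead of 3. *)
Lemma exp_le_term t : 0 <= t ->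
  exists k, expR t <= 3 * ((2 * t) ^+ k / k`!%:R).
Proof.
move=> t0; apply: contrapT => /forallNP small.
suff : expR t <= 2 / 3 * expR t.
  by rewrite ler_pMl ?expR_gt0// ler_pdivlMr// mul1r ler_nat.
rewrite {1}/expR; apply: limr_le; first exact: is_cvg_series_exp_coeff.
near=> N; rewrite /series /=.
have geo : \sum_(0 <= k < N) (2^-1 : R) ^+ k <= 2.
  rewrite (_ : \sum_(0 <= k < N) _ = series (geometric 1 2^-1) N); last first.
    by apply: eq_bigr => k _; rewrite /= mul1r.
  rewrite geometric_seriesE; last by rewrite lt_eqF// invf_lt1 ?ltr1n.
  rewrite /= mul1r -[X in _ / X](_ : 2^-1 = _); last by field.
  by rewrite invrK ler_piMl// gerBl exprn_ge0 ?invr_ge0.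
apply: (@le_trans _ _ (\sum_(0 <= k < N) expR t / 3 * 2^-1 ^+ k)).
  apply: ler_sum => k _.
  have /negP := small k; rewrite -ltNge => /ltW; rewrite -ler_pdivlMl// => sk.
  rewrite [leLHS](_ : _ = (2 * t) ^+ k / k`!%:R * 2^-1 ^+ k).
    by rewrite ler_wpM2r ?exprn_ge0 ?invr_ge0// (mulrC (expR t)).
  rewrite /exp_coeff /= exprMn mulrAC; congr (_ / _).
  by rewrite mulrC mulrA -exprMn mulVf ?expr1n ?mul1r ?pnatr_eq0.
by rewrite -mulr_sumr mulrC (mulrC (expR t)) mulrA ler_wpM2r ?expR_ge0// ler_wpM2r.
Unshelve. all: by end_near.
Qed.

Lemma power_le_exp t k : 0 <= t -> t ^+ k <= k`!%:R * expR t.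
Proof.
move=> t0; rewrite mulrC -ler_pdivrMr ?ltr0n ?fact_gt0//.
case: k => [|k]; first by rewrite expr0 divr1 -expR0 ler_expR.
by apply: le_trans (expR_ge1Dxn k t0); rewrite lerDr.
Qed.

End exponential.

(** * Moduli and derivatives of complex-valued functions *)

Section complex_modulus.
Context {R : realType}.
Implicit Types z w : R[i].

Lemma cmod_ge0 z : 0 <= cmod z.
Proof. by case: z => a b; rewrite /cmod /= sqrtr_ge0. Qed.

Lemma cmod0 : cmod (0 : R[i]) = 0.
Proof. by rewrite /cmod normr0. Qed.

Lemma cmodD z w : cmod (z + w) <= cmod z + cmod w.
Proof. exact: le_normcD. Qed.

Lemma cmodZ (r : R) z : cmod (real_complex R r * z) = `|r| * cmod z.
Proof.
by rewrite /cmod normrM !normc_def /= expr0n /= addr0 sqrtr_sqr mul0r subr0.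
Qed.

End complex_modulus.

Section derivatives.
Context {R : realType} {n : nat}.

Lemma partialsB (s : seq 'I_n) (f g : 'rV[R]_n -> R) : smooth f -> smooth g ->
  partials s (f - g) = partials s f - partials s g.
Proof.
move=> sf sg; elim: s => //= i s ->; apply/funext => x.
by rewrite deriveB//; [exact: (sf s).2|exact: (sg s).2].
Qed.

Lemma partials0 (s : seq 'I_n) : partials s 0 = 0 :> ('rV[R]_n -> R).
Proof.
by elim: s => //= i s ->; apply/funext => x; rewrite derive_cst.
Qed.

Lemma mderivB alpha (f g : cfun R n) x : csmooth f -> csmooth g ->
  mderiv alpha (f - g) x = mderiv alpha f x - mderiv alpha g x.
Proof.
move=> [rf jf] [rg jg]; rewrite /mderiv.
have -> : cRe (f - g) = cRe f - cRe g.
  by apply/funext => y; rewrite /cRe /= raddfB.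
have -> : cIm (f - g) = cIm f - cIm g.
  by apply/funext => y; rewrite /cIm /= raddfB.
by rewrite !partialsB.
Qed.

Lemma mderiv0 alpha x : mderiv alpha (0 : cfun R n) x = 0.
Proof.
rewrite /mderiv.
have -> : cRe (0 : cfun R n) = 0 by [].
have -> : cIm (0 : cfun R n) = 0 by [].
by rewrite !partials0.
Qed.

End derivatives.

(** * Conjugates and monomials *)

Section real_inequalities.
Context {R : realType} {n : nat}.
Local Notation Rn := 'rV[R]_n.
Implicit Types (x y : Rn) (beta : {ffun 'I_n -> nat}).

Lemma conjugate_ge (g : Rn -> \bar R) x y :
  ((dotp x y)%:E - g y <= conjugate g x)%E.
Proof. by apply: ereal_sup_ubound; exists y. Qed.

Lemma conjugate_real_ge (g : Rn -> R) x y c :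
  conjugate (EFin \o g) x = c%:E -> dotp x y - g y <= c.
Proof.
by move=> gc; rewrite -lee_fin -gc EFinB; exact: (@conjugate_ge (EFin \o g)).
Qed.

Lemma conjugate_fin_num (g : Rn -> R) x (M : R) :
  (forall y, dotp x y - g y <= M) ->
  conjugate (EFin \o g) x \is a fin_num.
Proof.
move=> gM; rewrite fin_real//; apply/andP; split.
  by apply: lt_le_trans (conjugate_ge _ x 0); rewrite -EFinB ltNyr.
by apply: (@le_lt_trans _ _ M%:E); rewrite ?ltry//; apply: ub_ereal_sup => _ [y _ <-];
  rewrite -EFinB lee_fin.
Qed.

Lemma expR_conjugate_le (g : Rn -> R) x c B :
  conjugate (EFin \o g) x = c%:E ->
  (forall y, expR (dotp x y - g y) <= B) -> expR c <= B.
Proof.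
move=> gc gB; have B0 : 0 < B by apply: lt_le_trans (gB 0); exact: expR_gt0.
rewrite -[B]lnK ?posrE// ler_expR -lee_fin -gc.
apply: ub_ereal_sup => _ [y _ <-].
by rewrite -EFinB lee_fin -ler_expR lnK ?posrE.
Qed.

Lemma expR_dotp x y : expR (dotp x y) = \prod_(i < n) expR (x 0 i * y 0 i).
Proof. exact: expR_sum. Qed.

Lemma expR_dotp_mvec beta y :
  expR (dotp (mvec R beta) y) = mpow (map_mx expR y) beta.
Proof.
rewrite expR_dotp; apply: eq_bigr => i _.
by rewrite !mxE expRM_natl.
Qed.

Lemma mpow_norm x beta : `|mpow x beta| = mpow (map_mx Num.norm x) beta.
Proof. by rewrite normr_prod; apply: eq_bigr => i _; rewrite normrX mxE. Qed.

Lemma mpowM_le x y beta : (forall i, 0 <= x 0 i * y 0 i) ->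
  mpow x beta * mpow y beta <= (mfact beta)%:R * expR (dotp x y).
Proof.
move=> xy; rewrite expR_dotp /mpow /mfact natr_prod -!big_split /=.
apply: ler_prod => i _; rewrite -exprMn exprn_ge0//=; exact: power_le_exp.
Qed.

Lemma expR_dotp_le_mpow x y : (forall i, 0 <= x 0 i * y 0 i) ->
  exists beta, expR (dotp x y) <=
    3 ^+ n * (mpow x beta * mpow (2 *: y) beta / (mfact beta)%:R).
Proof.
move=> xy.
have /choice[k hk] i := exp_le_term (xy i).
exists [ffun i => k i]; rewrite expR_dotp /mpow /mfact natr_prod.
rewrite -big_split -prodf_div /= -[X in 3 ^+ X]card_ord -prodr_const -big_split /=.
apply: ler_prod => i _; rewrite expR_ge0 /= ffunE !mxE -exprMn.
by rewrite [x 0 i * (2 * _)]mulrCA; exact: hk.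
Qed.

End real_inequalities.

(** * Conjugates of the weights *)

Section classA.
Context {R : realType} {n : nat} (g : 'rV[R]_n -> R).
Hypothesis gA : classA g.
Local Notation Rn := 'rV[R]_n.
Implicit Types (x y : Rn).

Lemma classA_ge0 y : g 0 <= g y.
Proof.
have [_ gabs gmono _] := gA; rewrite [g y]gabs.
set z := map_mx Num.norm y; have z0 : in_orthant z by move=> i; rewrite mxE.
suff [] : in_orthant (\sum_(i < n) z 0 i *: delta_mx 0 i) /\
    g 0 <= g (\sum_(i < n) z 0 i *: delta_mx 0 i).
  by rewrite -row_sum_delta.
apply: (big_rec (fun v => in_orthant v /\ g 0 <= g v)) => [|i v _ [v0 gv]].
  by split=> // i; rewrite mxE.
rewrite addrC; split; last by apply: le_trans gv _; exact: gmono.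
by move=> j; rewrite !mxE addr_ge0// mulr_ge0// ler0n.
Qed.

Lemma enorm_ge y i : `|y 0 i| <= enorm y.
Proof.
rewrite -sqrtr_sqr ler_wsqrtr// /dotp (bigD1 i)//= expr2 lerDl.
by apply: sumr_ge0 => j _; rewrite -expr2 sqr_ge0.
Qed.

Lemma dotp_le x y : dotp x y <= (\sum_i `|x 0 i|) * enorm y.
Proof.
rewrite mulr_suml; apply: ler_sum => i _.
apply: le_trans (ler_norm _) _; rewrite normrM.
by rewrite ler_wpM2l// enorm_ge.
Qed.

(** Where [enorm y] is large, superlinearity makes [dotp x y - g y] negative;
    elsewhere [dotp x y] is bounded and [g y >= g 0]. *)
Lemma conjugate_classA_fin_num x : conjugate (EFin \o g) x \is a fin_num.
Proof.
have [_ _ _ /(_ (\sum_i `|x 0 i|))[r gr]] := gA.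
set M := \sum_i _ in gr; have M0 : 0 <= M by apply: sumr_ge0.
apply: (@conjugate_fin_num _ _ _ _ (M * Num.max r 0 + `|g 0|)) => y.
have := dotp_le x y; rewrite -/M => xy.
have [yr|yr] := leP (enorm y) (Num.max r 0).
  have := classA_ge0 y; have := ler_wpM2l M0 yr; have := ler_norm (- g 0).
  rewrite normrN; lra.
move: yr; rewrite gt_max => /andP[ry y0].
have := gr y ry; rewrite ltr_pdivlMr// => Mg.
have := normr_ge0 (g 0); have : 0 <= M * Num.max r 0.
  by rewrite mulr_ge0// le_max lexx orbT.
lra.
Qed.

(** As [g] depends only on the moduli of the coordinates, the point where
    Young's inequality is used can be given the signs of [x]. *)
Lemma conjugate_ge_norm x y c : in_orthant y ->
  conjugate (EFin \o g) x = c%:E -> dotp (map_mx Num.norm x) y - g y <= c.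
Proof.
move=> y0 xc; have [_ gabs _ _] := gA.
pose z : Rn := \row_i (if 0 <= x 0 i then y 0 i else - y 0 i).
apply: le_trans (conjugate_real_ge z xc).
have -> : dotp x z = dotp (map_mx Num.norm x) y.
  apply: eq_bigr => i _; rewrite !mxE.
  by case: (ger0P (x 0 i)) => // _; rewrite mulrN mulNr.
rewrite [g z]gabs; suff -> : map_mx Num.norm z = y by [].
apply/rowP => i; rewrite !mxE.
by case: ifP => _; rewrite ?normrN ger0_norm.
Qed.

(** The duality between [exp_subst g] at [beta] and [g] at [x], before the
    supremum over [y] is taken. *)
Lemma mpow_exp_subst_le x y beta c : conjugate (EFin \o g) x = c%:E ->
  expR (dotp (mvec R beta) y - exp_subst g y) * `|mpow x beta| <=
  (mfact beta)%:R * expR c.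
Proof.
move=> xc; rewrite expRD expRN expR_dotp_mvec mpow_norm mulrAC.
rewrite ler_pdivrMr ?expR_gt0// mulrC.
apply: le_trans (mpowM_le _ _) _ => [i|].
  by rewrite !mxE mulr_ge0// expR_ge0.
rewrite -mulrA -expRD ler_wpM2l// ler_expR -lerBlDr.
by apply: (conjugate_ge_norm _ xc) => i; rewrite mxE expR_ge0.
Qed.

Lemma conjugate_exp_subst_fin_num beta :
  conjugate (EFin \o exp_subst g) (mvec R beta) \is a fin_num.
Proof.
(* At [x = (1, ..., 1)] the monomial in the duality bound is 1. *)
have /fineK/esym c1 := conjugate_classA_fin_num (const_mx 1).
set c := fine _ in c1; pose B := (mfact beta)%:R * expR c.
apply: (@conjugate_fin_num _ _ _ _ (ln B)) => y.
have := mpow_exp_subst_le y beta c1; rewrite -/B /mpow big1; last first.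
  by move=> i _; rewrite mxE expr1n.
rewrite normr1 mulr1 => yB; rewrite -ler_expR lnK// posrE.
by apply: lt_le_trans yB; exact: expR_gt0.
Qed.

End classA.

(** * Comparison of the norms *)

Section norms.
Context {R : realType} {n : nat}.
Local Notation Rn := 'rV[R]_n.
Local Notation cfun := (cfun R n).
Implicit Types (phi psi : Rn -> R) (f g h : cfun).

(** [GS_term] and [G_term] turn the quotients in the norms, taken in [\bar R],
    into real numbers once the conjugates are known to be finite. *)
Lemma GS_term (a c : R) : (a%:E / expeR (- c%:E) = (a * expR c)%:E)%E.
Proof. by rewrite /= inver gt_eqF ?expR_gt0// -EFinM expRN invrK. Qed.

Lemma G_term (a k c : R) : k != 0 ->
  (a%:E / (k%:E * expeR (- c%:E)) = (a * expR c / k)%:E)%E.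
Proof.
move=> k0; rewrite /= -EFinM inver mulf_eq0 (negPf k0) gt_eqF ?expR_gt0//=.
by rewrite -EFinM expRN invfM invrK mulrCA mulrC.
Qed.

Lemma mfact_neq0 (beta : {ffun 'I_n -> nat}) : (mfact beta)%:R != 0 :> R.
Proof.
by rewrite pnatr_eq0 -lt0n prodn_gt0// => i; exact: fact_gt0.
Qed.

Lemma G_norm_le_GS_norm phi m f : classA phi ->
  (G_norm (exp_subst phi) m f <= GS_norm phi m f)%E.
Proof.
move=> gA; apply: ub_ereal_sup => _ [x [alpha [beta [am ->]]]].
have /fineK/esym xc := conjugate_classA_fin_num gA x.
have /fineK/esym bd := conjugate_exp_subst_fin_num gA beta.
set c := fine _ in xc; set d := fine _ in bd.
apply: (@le_trans _ _ ((cmod (mderiv alpha f x))%:E /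
      expeR (- conjugate (EFin \o phi) x))%E); last first.
  by apply: ereal_sup_ubound; exists x, alpha.
rewrite xc bd GS_term G_term ?mfact_neq0// lee_fin cmodZ.
rewrite ler_pdivrMr ?lt0r ?mfact_neq0 ?ler0n// mulrAC mulrC -mulrA.
rewrite ler_wpM2l ?cmod_ge0// mulrC [leRHS]mulrC.
(* The supremum defining [d] can be bounded only once [|x^beta|] is moved to the
   other side. *)
have [->|x0] := eqVneq (mpow x beta) 0.
  by rewrite normr0 mulr0 mulr_ge0// expR_ge0.
rewrite -ler_pdivlMr ?normr_gt0//.
apply: (expR_conjugate_le bd) => y; rewrite ler_pdivlMr ?normr_gt0//.
exact: mpow_exp_subst_le.
Qed.

Lemma G_norm_ge psi m f x alpha beta : (mlen alpha <= m)%N ->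
  ((cmod (real_complex R (mpow x beta) * mderiv alpha f x))%:E /
    ((mfact beta)%:R%:E * expeR (- conjugate (EFin \o psi) (mvec R beta))) <=
  G_norm psi m f)%E.
Proof. by move=> am; apply: ereal_sup_ubound; exists x, alpha, beta. Qed.

Lemma GS_norm_ge phi m f x alpha : (mlen alpha <= m)%N ->
  ((cmod (mderiv alpha f x))%:E / expeR (- conjugate (EFin \o phi) x) <=
  GS_norm phi m f)%E.
Proof. by move=> am; apply: ereal_sup_ubound; exists x, alpha. Qed.

Lemma G_weight_ge0 psi (beta : {ffun 'I_n -> nat}) :
  (0 <= ((mfact beta)%:R%:E *
         expeR (- conjugate (EFin \o psi) (mvec R beta)))^-1)%E.
Proof. by rewrite inve_ge0 mule_ge0 ?expeR_ge0// lee_fin ler0n. Qed.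

Lemma GS_weight_ge0 phi x : (0 <= (expeR (- conjugate (EFin \o phi) x))^-1)%E.
Proof. by rewrite inve_ge0 expeR_ge0. Qed.

Lemma mlen0 : mlen [ffun _ : 'I_n => 0%N] = 0%N.
Proof. by rewrite /mlen big1// => i _; rewrite ffunE. Qed.

Lemma G_norm_ge0 psi m f : (0 <= G_norm psi m f)%E.
Proof.
apply: le_trans (G_norm_ge psi f 0 [ffun=> 0%N] (alpha := [ffun=> 0%N]) _).
  by rewrite mule_ge0 ?G_weight_ge0// lee_fin cmod_ge0.
by rewrite mlen0.
Qed.

Lemma GS_norm_ge0 phi m f : (0 <= GS_norm phi m f)%E.
Proof.
apply: le_trans (GS_norm_ge phi f 0 (alpha := [ffun=> 0%N]) _).
  by rewrite mule_ge0 ?GS_weight_ge0// lee_fin cmod_ge0.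
by rewrite mlen0.
Qed.

Lemma G_norm0 psi m : (G_norm psi m (0 : cfun) <= 0)%E.
Proof.
apply: ub_ereal_sup => _ [x [alpha [beta [_ ->]]]].
by rewrite mderiv0 mulr0 cmod0 mul0e.
Qed.

Lemma GS_norm0 phi m : (GS_norm phi m (0 : cfun) <= 0)%E.
Proof.
apply: ub_ereal_sup => _ [x [alpha [_ ->]]].
by rewrite mderiv0 cmod0 mul0e.
Qed.

(** The weights may a priori be infinite, so the products live in [\bar R]. *)
Lemma cmod_weighted_triangle (w : \bar R) (a b c : R[i]) : (0 <= w)%E ->
  ((cmod (c - a))%:E * w <= (cmod (c - b))%:E * w + (cmod (b - a))%:E * w)%E.
Proof.
move=> w0; rewrite -ge0_muleDl ?lee_fin ?cmod_ge0// lee_wpmul2r// lee_fin.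
by rewrite -(subrKA b c) cmodD.
Qed.

Lemma G_norm_triangle psi m f g h : csmooth f -> csmooth g -> csmooth h ->
  (G_norm psi m (h - f)%R <= G_norm psi m (h - g)%R + G_norm psi m (g - f)%R)%E.
Proof.
move=> sf sg sh; apply: ub_ereal_sup => _ [x [alpha [beta [am ->]]]].
apply: le_trans (leeD (G_norm_ge psi _ x beta am) (G_norm_ge psi _ x beta am)).
rewrite !mderivB// !mulrBr; apply: cmod_weighted_triangle.
exact: G_weight_ge0.
Qed.

Lemma GS_norm_triangle phi m f g h : csmooth f -> csmooth g -> csmooth h ->
  (GS_norm phi m (h - f)%R <=
   GS_norm phi m (h - g)%R + GS_norm phi m (g - f)%R)%E.
Proof.
move=> sf sg sh; apply: ub_ereal_sup => _ [x [alpha [am ->]]].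
apply: le_trans (leeD (GS_norm_ge phi _ x am) (GS_norm_ge phi _ x am)).
rewrite !mderivB//; apply: cmod_weighted_triangle.
exact: GS_weight_ge0.
Qed.

(** [exp_subst phi] sees only points with positive coordinates, and [x] may have
    zero ones: hence the translation by [(1, ..., 1)], which also increases the
    monomial. *)
Lemma mpow_le_conjugate phi psi (C d : R) (beta : {ffun 'I_n -> nat}) x :
  (forall y, in_orthant y -> phi (2 *: y + const_mx 1) <= psi y + C) ->
  conjugate (EFin \o exp_subst phi) (mvec R beta) = d%:E -> in_orthant x ->
  mpow (2 *: x) beta <= expR (d + (psi x + C)).
Proof.
move=> phipsi bd x0; pose w := map_mx (@ln R) (2 *: x + const_mx 1).
have ew : map_mx expR w = 2 *: x + const_mx 1.
  apply/rowP => i; rewrite !mxE lnK// posrE.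
  by rewrite (lt_le_trans ltr01)// lerDr mulr_ge0.
apply: (@le_trans _ _ (mpow (2 *: x + const_mx 1) beta)).
  apply: ler_prod => i _; rewrite !mxE exprn_ge0 ?mulr_ge0//=.
  by rewrite lerXn2r ?nnegrE ?addr_ge0 ?mulr_ge0// lerDl.
rewrite -ew -expR_dotp_mvec ler_expR -lerBlDr.
apply: le_trans (conjugate_real_ge w bd).
by rewrite lerD2l lerN2 /exp_subst ew phipsi.
Qed.

(** The multi-index [beta] is chosen after the point [y] at which the conjugate of
    [psi] is tested, which is harmless because the moment bounds on [f] are
    uniform in [beta]. *)
Lemma GS_norm_le_G_norm phi psi (C : R) m f : classA phi -> classA psi ->
  (forall y, in_orthant y -> phi (2 *: y + const_mx 1) <= psi y + C) ->
  (GS_norm psi m f <= (3 ^+ n * expR C)%:E * G_norm (exp_subst phi) m f)%E.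
Proof.
move=> phiA psiA phipsi; apply: ub_ereal_sup => _ [x [alpha [am ->]]].
have C0 : 0 < 3 ^+ n * expR C by rewrite mulr_gt0 ?expR_gt0 ?exprn_gt0.
have /fineK/esym xc := conjugate_classA_fin_num psiA x.
rewrite xc GS_term; set D := cmod _; set c := fine _ in xc *.
have := G_norm_ge0 (exp_subst phi) m f.
case E : G_norm => [G| |]; last by [].
- rewrite lee_fin => G0; rewrite -EFinM lee_fin.
  have [->|D0] := eqVneq D 0; first by rewrite mul0r !mulr_ge0// ltW.
  have {}D0 : 0 < D by rewrite lt0r D0 cmod_ge0.
  rewrite -ler_pdivlMl// mulrC; apply: (expR_conjugate_le xc) => y.
  rewrite ler_pdivlMr//.
  (* Both sides of the estimate are controlled by the moduli of the coordinates,
     so the signs of [x] and [y] are dropped. *)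
  pose x' := map_mx Num.norm x; pose y' := map_mx Num.norm y.
  have y'0 : in_orthant y' by move=> i; rewrite mxE.
  have xy i : 0 <= x' 0 i * y' 0 i by rewrite !mxE mulr_ge0.
  have [beta] := expR_dotp_le_mpow xy.
  have /fineK/esym bd := conjugate_exp_subst_fin_num phiA beta.
  set d := fine _ in bd.
  have := mpow_le_conjugate phipsi bd y'0.
  have := G_norm_ge (exp_subst phi) f x beta am.
  rewrite E bd G_term ?mfact_neq0// lee_fin cmodZ mpow_norm -/D.
  have -> : psi y' = psi y by case: psiA => _ /(_ y) ->.
  move=> hG h2 h3.
  have dxy : dotp x y <= dotp x' y'.
    apply: ler_sum => i _; rewrite !mxE -normrM; exact: ler_norm.
  have X0 : 0 <= mpow x' beta by apply: prodr_ge0 => i _; rewrite mxE exprn_ge0.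
  apply: (@le_trans _ _ (3 ^+ n *
    (mpow x' beta * expR (d + (psi y + C)) / (mfact beta)%:R) * expR (- psi y) * D)).
    rewrite ler_wpM2r ?cmod_ge0// expRD ler_wpM2r ?expR_ge0//.
    apply: (@le_trans _ _ (expR (dotp x' y'))); first by rewrite ler_expR.
    apply: le_trans h3 _; rewrite ler_wpM2l ?exprn_ge0// ler_wpM2r ?invr_ge0 ?ler0n//.
    by rewrite ler_wpM2l.
  rewrite (_ : _ * D = 3 ^+ n * expR C * (mpow x' beta * D * expR d / (mfact beta)%:R)).
    by rewrite ler_wpM2l// ltW.
  rewrite !expRD expRN; field.
  by rewrite mfact_neq0 gt_eqF ?expR_gt0.
- by move=> _; rewrite gt0_muley ?lte_fin// leey.
Qed.

End norms.

(** * Comparison of the spaces *)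

Section spaces.
Context {R : realType} {n : nat}.
Implicit Types phi psi : 'rV[R]_n -> R.

Lemma GS_sub_G phi : classA phi -> GS_space phi `<=` G_space (exp_subst phi).
Proof.
move=> phiA f [sf fin]; split=> // m.
by apply: le_lt_trans (G_norm_le_GS_norm m f phiA) (fin m).
Qed.

Lemma G_sub_GS phi psi (C : R) : classA phi -> classA psi ->
  (forall y, in_orthant y -> phi (2 *: y + const_mx 1) <= psi y + C) ->
  G_space (exp_subst phi) `<=` GS_space psi.
Proof.
move=> phiA psiA phipsi f [sf fin]; split=> // m.
apply: le_lt_trans (GS_norm_le_G_norm m f phiA psiA phipsi) _.
by rewrite lte_mul_pinfty ?lee_fin// mulr_ge0 ?expR_ge0 ?exprn_ge0.
Qed.

End spaces.

Theorem theorem4 (R : realType) (n : nat) (phi : nat -> 'rV[R]_n -> R)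
  (hn : (0 < n)%N)
  (phiA : forall nu, classA (phi nu))
  (phi_convex : forall nu,
     convex_function [set: convex_lmodType 'rV[R]_n] (phi nu))
  (i0 : forall nu (A : R), 0 < A -> exists C : R, 0 < C /\
     forall x, phi nu x + A * ln (1 + enorm x) <= phi nu.+1 x + C)
  (i2 : forall nu, exists K : R, 0 < K /\
     forall x xi : 'rV[R]_n, in_orthant x -> (forall i, 0 <= xi 0 i <= 1) ->
       phi nu (x + xi) <= phi nu.+1 x + K)
  (i3 : forall nu, exists a : R, 0 < a /\
     forall x : 'rV[R]_n, phi nu (2 *: x) <= phi nu.+1 x + a) :
  \bigcup_nu G_space (exp_subst (phi nu)) = \bigcup_nu GS_space (phi nu) /\
  ind_limit_open (fun nu => G_space (exp_subst (phi nu))) (fun nu => G_norm (exp_subst (phi nu))) =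
  ind_limit_open (fun nu => GS_space (phi nu)) (fun nu => GS_norm (phi nu)).
Proof.
have dilate nu : exists C : R, forall y, in_orthant y ->
    phi nu (2 *: y + const_mx 1) <= phi nu.+2 y + C.
  have [K [_ hK]] := i2 nu; have [a [_ ha]] := i3 nu.+1.
  exists (a + K) => y y0.
  apply: (@le_trans _ _ (phi nu.+1 (2 *: y) + K)).
    apply: hK => i; first by rewrite mxE mulr_ge0.
    by rewrite mxE ler01 lexx.
  by rewrite addrA lerD2r.
have GS_G nu := @GS_sub_G _ _ _ (phiA nu).
have G_GS nu : G_space (exp_subst (phi nu)) `<=` GS_space (phi nu.+2).
  by have [C hC] := dilate nu; exact: G_sub_GS hC.
have unions : \bigcup_nu G_space (exp_subst (phi nu)) =
    \bigcup_nu GS_space (phi nu).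
  apply/seteqP; split=> f [nu _ hf]; first by exists nu.+2 => //; exact: G_GS.
  by exists nu => //; exact: GS_G.
split=> //; apply/seteqP; split.
- apply: ind_limit_open_sub => // nu; exists nu, (GS_G nu).
  apply: seminormed_incl_open => [m f|m f g h|m|m].
  + exact: G_norm_ge0.
  + by move=> [sf _] [sg _] [sh _]; exact: G_norm_triangle.
  + exact: GS_norm0.
  + by exists 1 => // f; rewrite mul1e; exact: G_norm_le_GS_norm.
- apply: ind_limit_open_sub => // nu; exists nu.+2, (G_GS nu).
  apply: seminormed_incl_open => [m f|m f g h|m|m].
  + exact: GS_norm_ge0.
  + by move=> [sf _] [sg _] [sh _]; exact: GS_norm_triangle.
  + exact: G_norm0.
  + have [C hC] := dilate nu; exists (3 ^+ n * expR C) => [|f].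
      by rewrite mulr_gt0 ?expR_gt0 ?exprn_gt0.
    exact: GS_norm_le_G_norm.
Qed.
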